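(* Let $X$, $Y$ be nonempty sets and let $\Phi$, $\Psi$ be mappings with the domains $X^{2}$ and $Y^{2}$, respectively. If $\Phi$ and $\Psi$ are combinatorially similar, then the semigroups $\mathcal{B}_X(P_{\Phi^{-1}})$ and $\mathcal{B}_Y(P_{\Psi^{-1}})$ are isomorphic.
   Context: Mappings $\Phi$, $\Psi$ may take values in arbitrary sets; $\Phi(X^2)$, $\Psi(Y^2)$ are their images. $\Phi$ is combinatorially similar to $\Psi$ if there are bijections $f\colon\Phi(X^2)\to\Psi(Y^2)$ and $g\colon Y\to X$ such that $\Psi(x,y)=f(\Phi(g(x),g(y)))$ for all $x,y\in Y$. $\mathcal{B}_X$ denotes the semigroup of all binary relations on $X$ (all subsets of $X^2$) under composition $\circ$, where $\langle x,y\rangle\in\psi\circ\gamma$ if and only if there is $z\in X$ with $\langle x,z\rangle\in\psi$ and $\langle z,y\rangle\in\gamma$. For a nonempty $A\subseteq\mathcal{B}_X$, $\mathcal{B}_X(A)$ denotes the subsemigroup of $\mathcal{B}_X$ generated by $A$ (all finite compositions of one or more elements of $A$). $P_{\Phi^{-1}}:=\{\Phi^{-1}(a):a\in\Phi(X^2)\}\subseteq\mathcal{B}_X$ is the set of fibers of $\Phi$; similarly $P_{\Psi^{-1}}\subseteq\mathcal{B}_Y$. Semigroups are isomorphic if there is a bijective multiplication-preserving map between them. *)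

(* Defs.v *)
From HB Require Import structures.
From mathcomp Require Import all_boot.
From mathcomp Require Import boolp classical_sets functions.

Set Implicit Arguments.
Unset Strict Implicit.
Unset Printing Implicit Defensive.

Local Open Scope classical_set_scope.
Local Open Scope group_scope.

Section Generated.
Variable G : semigroupType.

(* The products x * s_0 * ... * s_(n-1), n >= 0, with all factors in A. *)
Definition generated (A : set G) : set G :=
  [set p | exists x (s : seq G),
     [/\ A x, {in s, forall y, A y} & p = foldl *%g x s]].

Lemma mul_foldl (x y : G) s :
  x * foldl *%g y s = foldl *%g (x * y) s.
Proof. by elim: s y => //= z s IHs y; rewrite IHs mulgA. Qed.

Lemma generated_mulg_closed (A : set G) :
  mulg_closed (fun p : G => p \in generated A).
Proof.
move=> p q /set_mem[x [s [Ax As ->]]] /set_mem[y [t [Ay At ->]]].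
apply/mem_set; exists x, (s ++ y :: t); split => //.
  by move=> z; rewrite mem_cat in_cons => /or3P[/As|/eqP->|/At].
by rewrite foldl_cat /= mul_foldl.
Qed.

Definition generated_type (A : set G) : Type := {p : G | p \in generated A}.

HB.instance Definition _ (A : set G) := SubChoice.on (generated_type A).
HB.instance Definition _ (A : set G) :=
  SubChoice_isSubSemigroup.Build G _ (generated_type A)
    (@generated_mulg_closed A).

Lemma generatedE (A : set G) :
  generated A =
  smallest [set S : set G | forall u v, S u -> S v -> S (u * v)] A.
Proof.
apply/seteqP; split.
  move=> p [x [s [Ax As ->]]] S [SM sAS].
  elim: s x {Ax}(sAS _ Ax) As => //= y s IHs x Sx As; apply: IHs.
    by apply: SM => //; apply: sAS; apply: As; rewrite in_cons eqxx.
  by move=> z sz; apply: As; rewrite in_cons sz orbT.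
apply: smallest_sub => [u v /mem_set Su /mem_set Sv|x Ax].
  exact/set_mem/generated_mulg_closed.
by exists x, [::].
Qed.

End Generated.

Definition isomorphic (G H : semigroupType) : Prop :=
  exists F : {multiplicative G -> H}, bijective F.

Definition binrel (X : Type) : Type := set (X * X).

HB.instance Definition _ (X : Type) := Choice.copy (binrel X) (set (X * X)).

Section BinrelSemigroup.
Variable X : Type.

(* psi o gamma relates x to y when x psi z and z gamma y for some z; the
   library's [\;] takes its arguments in the opposite order. *)
Definition binrel_comp (psi gamma : binrel X) : binrel X :=
  (gamma \; psi)%relation.

Lemma binrel_compA : associative binrel_comp.
Proof.
move=> p q r; apply/seteqP; split => -[x y] [z /=].
  by move=> pxz [w qzw rwy]; exists w => //; exists z.
by move=> [w pxw qwz] rzy; exists w => //; exists z.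
Qed.

HB.instance Definition _ := isSemigroup.Build (binrel X) binrel_compA.

End BinrelSemigroup.

Section Mappings.
Variables (X Y A B : Type).

Definition fibers (Phi : X * X -> A) : set (binrel X) :=
  [set Phi @^-1` [set a] | a in range Phi].

(* Only the values of f on the image of Phi matter: set_bij asks that f
   restrict to a bijection from range Phi onto range Psi. Taking f total on A
   loses nothing when Y is nonempty, since B is then nonempty too. *)
Definition comb_similar (Phi : X * X -> A) (Psi : Y * Y -> B) : Prop :=
  exists (f : A -> B) (g : Y -> X),
    [/\ set_bij (range Phi) (range Psi) f,
        bijective g &
        forall x y : Y, Psi (x, y) = f (Phi (g x, g y))].

End Mappings.

(* Main.v *)
(* Transporting relations along the bijection g : Y -> X is an isomorphism from
   the semigroup of all relations on X onto that of Y. It sends the fiber of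
   Phi over a to the fiber of Psi over f a, so it matches the two generating
   sets and restricts to the subsemigroups they generate. *)
From HB Require Import structures.
Require Import Defs.
From mathcomp Require Import all_boot.
From mathcomp Require Import boolp classical_sets functions.

Set Implicit Arguments.
Unset Strict Implicit.
Unset Printing Implicit Defensive.

Local Open Scope classical_set_scope.
Local Open Scope group_scope.

Lemma generated_image (G H : semigroupType) (F : G -> H) (A : set G) :
  {morph F : x y / x * y} -> F @` generated A = generated (F @` A).
Proof.
move=> FM; have Ffoldl x s : F (foldl *%g x s) = foldl *%g (F x) (map F s).
  by elim: s x => //= y s IHs x; rewrite IHs FM.
apply/seteqP; split => [_ [_ [x [s [Ax As ->]]] <-]|_ [_ [t [[x Ax <-] At ->]]]].
  exists (F x), (map F s); split; [by exists x| |exact: Ffoldl].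
  by move=> _ /mapP[y sy ->]; exists y => //; apply: As.
(* [F] need not be injective here, so a preimage in [A] is chosen for each factor by induction on
   [t]. *)
have [s As ->] : exists2 s, {in s, forall y, A y} & t = map F s.
  elim: t At => [|y t IHt] At; first by exists [::].
  have [z Az <-] : (F @` A) y by apply: At; rewrite mem_head.
  have [|s As ->] := IHt; first by move=> w tw; apply: At; rewrite in_cons tw orbT.
  exists (z :: s) => // w; rewrite in_cons => /predU1P[->//|]; exact: As.
by exists (foldl *%g x s) => //; exists x, s.
Qed.

Lemma isomorphic_generated (G H : semigroupType) (F : G -> H) (A : set G) :
    {morph F : x y / x * y} -> bijective F ->
  isomorphic (generated_type A) (generated_type (F @` A)).
Proof.
move=> FM [F' FK F'K].
have FA (p : generated_type A) : F (val p) \in generated (F @` A).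
  by apply/mem_set; rewrite -generated_image//; exists (val p) => //; apply/set_mem/valP.
(* The inverse also restricts: [val q] is [F p] for some generated [p], and [F'] sends it back to
   [p]. *)
have F'A (q : generated_type (F @` A)) : F' (val q) \in generated A.
  have [p Ap <-] : (F @` generated A) (val q).
    by rewrite generated_image//; apply/set_mem/valP.
  by rewrite FK; apply/mem_set.
pose f p : generated_type (F @` A) := Sub (F (val p)) (FA p).
have fM : {morph f : p q / p * q}.
  by move=> p q; apply: val_inj; rewrite /f/= FM.
pose fm := isMultiplicative.Build _ _ f fM.
pose fmul : {multiplicative generated_type A -> generated_type (F @` A)} :=
  HB.pack f fm.
exists fmul; exists (fun q => Sub (F' (val q)) (F'A q)) => p; apply: val_inj.
  by rewrite /= FK.
by rewrite /= F'K.
Qed.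

Section Pullback.
Variables (X Y : Type) (g : Y -> X).

Definition binrel_pullback (r : binrel X) : binrel Y :=
  [set p | r (g p.1, g p.2)].

Hypothesis g_bij : bijective g.

Lemma binrel_pullbackM : {morph binrel_pullback : r s / r * s}.
Proof.
have [g' gK g'K] := g_bij; move=> r s; apply/seteqP; split => -[x y] [z /=].
  (* The intermediate point [z] lies in [X]; surjectivity of [g] moves it to [Y]. *)
  by move=> rxz szy; exists (g' z); rewrite /binrel_pullback /= g'K.
by move=> rxz szy; exists (g z).
Qed.

Lemma binrel_pullback_bij : bijective binrel_pullback.
Proof.
have [g' gK g'K] := g_bij.
exists (fun s : binrel Y => [set p | s (g' p.1, g' p.2)] : binrel X) => r;
  apply/seteqP; split => -[x y];
  by rewrite /binrel_pullback /= ?gK ?g'K.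
Qed.

Lemma binrel_pullback_fibers (A B : Type) (f : A -> B)
    (Phi : X * X -> A) (Psi : Y * Y -> B) :
    set_bij (range Phi) (range Psi) f ->
    (forall x y, Psi (x, y) = f (Phi (g x, g y))) ->
  binrel_pullback @` fibers Phi = fibers Psi.
Proof.
move=> [fsub finj fsurj] PsiE.
have pullE a : range Phi a ->
    binrel_pullback (Phi @^-1` [set a]) = Psi @^-1` [set f a].
  move=> Ra; apply/seteqP; split => -[x y]; rewrite /binrel_pullback /= PsiE.
    by move=> ->.
  (* [f] is injective only on [range Phi], so both [a] and [Phi (g x, g y)] must be seen to lie
     there. *)
  by apply: finj; apply/mem_set => //; exists (g x, g y).
apply/seteqP; split => [_ [_ [a Ra <-] <-]|_ [b Rb <-]].
  by rewrite pullE//; exists (f a) => //; exact: fsub.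
(* Surjectivity of [f] onto [range Psi] ensures that no fiber of [Psi] is missed. *)
have [a Ra <-] := fsurj b Rb.
by exists (Phi @^-1` [set a]); [exists a|rewrite pullE].
Qed.

End Pullback.

Unset Implicit Arguments.

Theorem proposition4p16 (X Y A B : Type)
    (X_nonempty : inhabited X) (Y_nonempty : inhabited Y)
    (Phi : X * X -> A) (Psi : Y * Y -> B) :
  comb_similar Phi Psi ->
  isomorphic (generated_type (fibers Phi)) (generated_type (fibers Psi)).
Proof.
move=> [f [g [f_bij g_bij PsiE]]].
rewrite -(binrel_pullback_fibers f_bij PsiE).
apply: isomorphic_generated; first exact: binrel_pullbackM.
exact: binrel_pullback_bij.
Qed.
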